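(* Let $(S,d)$ be a complete separable metric space and let $M\subset\mathcal{M}(S)$ be such that $\sup_{\mu\in M}\|\mu\|_{\mathrm{TV}}<\infty$ and $M$ is uniformly tight. Then the $\sigma(\mathcal{M}(S),\mathrm{BL}(S))$-weak topology coincides with the $\|\cdot\|_{\mathrm{BL}}^*$-norm topology on $M$ (i.e. the restrictions of these two topologies to $M$ are equal).
   Context: $\mathcal{M}(S)$ is the space of finite signed Borel measures on $S$ and $\langle\mu,f\rangle:=\int_S f\,d\mu$. $\mathrm{BL}(S)$ is the space of bounded real-valued Lipschitz functions on $(S,d)$ with norm $\|f\|_{\mathrm{BL}}:=\|f\|_\infty+|f|_L$, where $|f|_L:=\sup\{|f(x)-f(y)|/d(x,y):x\neq y\}$. The $\sigma(\mathcal{M}(S),\mathrm{BL}(S))$-weak topology is the coarsest topology on $\mathcal{M}(S)$ making $\mu\mapsto\langle\mu,f\rangle$ continuous for every $f\in\mathrm{BL}(S)$. The dual bounded Lipschitz norm is $\|\mu\|_{\mathrm{BL}}^*:=\sup\{|\langle\mu,f\rangle|:f\in\mathrm{BL}(S),\ \|f\|_{\mathrm{BL}}\le1\}$, and $\|\mu\|_{\mathrm{TV}}:=|\mu|(S)$. A family $M\subset\mathcal{M}(S)$ is uniformly tight if for every $\varepsilon>0$ there is a compact set $K_\varepsilon\subset S$ with $|\mu|(S\setminus K_\varepsilon)<\varepsilon$ for all $\mu\in M$. *)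

(* Defs.v *)
From HB Require Import structures.
From mathcomp Require Import all_boot all_order all_algebra.
From mathcomp Require Import all_classical all_reals all_analysis.
From mathcomp Require Import lra.

Set Implicit Arguments.
Unset Strict Implicit.
Unset Printing Implicit Defensive.

Import Order.TTheory GRing.Theory Num.Theory.
Import numFieldNormedType.Exports.

Local Open Scope classical_set_scope.
Local Open Scope ring_scope.

(* [Complete] carries a point (needed by [measurableType]), so these spaces
   are nonempty. *)
#[short(type="completeMetricType")]
HB.structure Definition CompleteMetric (R : numDomainType) :=
  {T of Metric R T & Complete T}.

Definition separable_space (T : topologicalType) :=
  exists2 D : set T, countable D & dense D.

Section bounded_lipschitz.
Context {R : realType} (S : completeMetricType R).

Definition BL : set (S -> R) := [set f |
  [bounded f x | x in [set: S]] /\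
  (exists L, forall x y, `|f x - f y| <= L * mdist x y)].

Definition sup_norm (f : S -> R) : R := sup [set `|f x| | x in [set: S]].

(* [sup set0 = 0], so this is [0] when [S] is a single point. *)
Definition lipschitz_seminorm (f : S -> R) : R :=
  sup [set `|f xy.1 - f xy.2| / mdist xy.1 xy.2 |
       xy in [set xy : S * S | xy.1 != xy.2]].

Definition BL_norm (f : S -> R) : R := sup_norm f + lipschitz_seminorm f.

End bounded_lipschitz.
Arguments BL {R} S.

Definition borel {R : realType} (S : completeMetricType R) :
  measurableType (@open S).-sigma := g_sigma_algebraType (@open S).

Section signed_measures.
Context {R : realType} (S : completeMetricType R).

(* A charge is a function on all subsets, unconstrained on the non-Borel ones.
   Everything below only depends on its values on Borel sets: two charges that
   agree there stand for the same signed measure, and belong to the same open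
   sets of both topologies. *)
Definition signed_measure : Type := {charge set (borel S) -> \bar R}.
HB.instance Definition _ := gen_eqMixin signed_measure.
HB.instance Definition _ := gen_choiceMixin signed_measure.

Definition diff_measure (mu nu : signed_measure) : signed_measure :=
  cadd mu (copp nu).

End signed_measures.

Section signed_measure_functionals.
Context {R : realType} {S : completeMetricType R}.
Implicit Types mu nu : signed_measure S.

Lemma hahn_ex mu : {PN : set (borel S) * set (borel S) |
  hahn_decomposition mu PN.1 PN.2}.
Proof. by apply: cid; have [P [N ?]] := Hahn_decomposition mu; exists (P, N). Qed.

Definition hahn mu := proj2_sig (hahn_ex mu).

(* The Jordan parts and the total variation measure do not depend, on Borel
   sets, on the Hahn decomposition ([Hahn_decomposition_uniq]). *)
Definition pos_part mu : {finite_measure set (borel S) -> \bar R} :=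
  jordan_pos (hahn mu).

Definition neg_part mu : {finite_measure set (borel S) -> \bar R} :=
  jordan_neg (hahn mu).

Definition variation mu : {measure set (borel S) -> \bar R} :=
  charge_variation (hahn mu).

Definition TV_norm mu : \bar R := variation mu [set: borel S].

Definition pairing mu (f : S -> R) : R :=
  \int[pos_part mu]_x f x - \int[neg_part mu]_x f x.

Definition dual_BL_norm mu : R :=
  sup [set `|pairing mu f| | f in [set f | BL S f /\ BL_norm f <= 1]].

Definition uniformly_tight (M : set (signed_measure S)) :=
  forall e : R, 0 < e -> exists2 K : set S, compact K &
    forall mu, M mu -> (variation mu (~` K) < e%:E)%E.

End signed_measure_functionals.

Definition weak_BL {R : realType} (S : completeMetricType R) : Type :=
  sup_topology (fun f : BL S => Topological.on
    (initial_topology (fun mu : signed_measure S => pairing mu (val f)))).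
HB.instance Definition _ (R : realType) (S : completeMetricType R) :=
  Topological.on (weak_BL S).

Definition weak_BL_open {R : realType} (S : completeMetricType R) :
  set (set (signed_measure S)) := @open (weak_BL S).
Arguments weak_BL_open {R} S _.

Section dual_BL_pseudometric.
Context {R : realType} {S : completeMetricType R}.
Implicit Types (mu nu : signed_measure S) (f : S -> R).

Lemma BL_measurable f : BL S f -> measurable_fun [set: borel S] f.
Proof.
move=> [_ [L fL]].
have cf : continuous f.
  move=> x; apply/cvgrPdist_lt => e e0.
  have L0 : 0 < `|L| + 1 by rewrite ltr_wpDl.
  have := nbhsx_ballx x (e / (`|L| + 1)) (divr_gt0 e0 L0).
  apply: filterS => y; rewrite ballEmdist/= ltr_pdivlMr// => xy.
  apply: le_lt_trans (fL x y) (le_lt_trans _ xy).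
  rewrite mulrC ler_wpM2l ?mdist_ge0//.
  by rewrite (le_trans (ler_norm L))// lerDl.
apply: (measurability _ (measurable_realfun.RGenOpens.measurableE R)) => _ [_ [a [b ->]] <-].
rewrite setTI; apply: sub_sigma_algebra.
by move/continuousP: cf; apply; exact: interval_open.
Qed.

Lemma BL_integrable (m : {measure set (borel S) -> \bar R}) f :
  (m setT < +oo)%E -> BL S f -> m.-integrable setT (EFin \o f).
Proof.
move=> mfin fBL; apply: measurable_bounded_integrable => //.
- exact: BL_measurable.
- by case: fBL.
Qed.

Lemma Rintegral_add (m1 m2 : {measure set (borel S) -> \bar R}) f :
  (m1 setT < +oo)%E -> (m2 setT < +oo)%E -> BL S f ->
  \int[measure_add m1 m2]_x f x = \int[m1]_x f x + \int[m2]_x f x.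
Proof.
move=> m1fin m2fin fBL.
have I1 := BL_integrable m1fin fBL; have I2 := BL_integrable m2fin fBL.
rewrite /Rintegral integral_measure_add// fineD//; exact: integrable_fin_num.
Qed.

Lemma jordanE mu (A : set (borel S)) : measurable A ->
  mu A = (pos_part mu A - neg_part mu A)%E.
Proof.
by move=> mA; rewrite (jordan_decomp (hahn mu) mA) /cadd/= cscaleN1.
Qed.

Lemma pairing_diff mu nu f : BL S f ->
  pairing (diff_measure mu nu) f = pairing mu f - pairing nu f.
Proof.
move=> fBL; set d := diff_measure mu nu.
have fin (m : {finite_measure set (borel S) -> \bar R}) : (m setT < +oo)%E.
  by rewrite -ge0_fin_numE// fin_num_measure.
have fin2 (m1 m2 : {finite_measure set (borel S) -> \bar R}) :
    (measure_add m1 m2 setT < +oo)%E.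
  by rewrite measure_addE; apply: lte_add_pinfty; exact: fin.
pose lhs := measure_add (measure_add (pos_part d) (neg_part mu)) (pos_part nu).
pose rhs := measure_add (measure_add (neg_part d) (pos_part mu)) (neg_part nu).
have : \int[lhs]_x f x = \int[rhs]_x f x.
  rewrite /Rintegral; congr (fine _); apply: eq_measure_integral => A mA _.
  have finA (m : {finite_measure set (borel S) -> \bar R}) :
      m A = (fine (m A))%:E by rewrite fineK// fin_num_measure.
  have addE (m1 m2 m3 : {finite_measure set (borel S) -> \bar R}) :
      measure_add (measure_add m1 m2) m3 A =
      (fine (m1 A) + fine (m2 A) + fine (m3 A))%:E.
    rewrite !EFinD -!finA measure_addE; congr (_ + _)%E.
    exact: measure_addE.
  apply: etrans (addE _ _ _) (etrans _ (esym (addE _ _ _))).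
  have : d A = (mu A - nu A)%E by [].
  rewrite !jordanE//.
  rewrite (finA (pos_part d)) (finA (neg_part d)) (finA (pos_part mu)).
  rewrite (finA (neg_part mu)) (finA (pos_part nu)) (finA (neg_part nu)).
  by case=> dE; apply: (congr1 EFin); lra.
have addE (m1 m2 m3 : {finite_measure set (borel S) -> \bar R}) :
    \int[measure_add (measure_add m1 m2) m3]_x f x =
    \int[m1]_x f x + \int[m2]_x f x + \int[m3]_x f x.
  rewrite (Rintegral_add (fin2 m1 m2) (fin m3) fBL).
  by congr (_ + _); exact: (Rintegral_add (fin m1) (fin m2) fBL).
move=> E; have {E} := etrans (esym (addE _ _ _)) (etrans E (addE _ _ _)).
rewrite /pairing; lra.
Qed.

Lemma dual_BL_ball0 : BL S (cst 0) /\ BL_norm (cst (0 : R) : S -> R) <= 1.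
Proof.
split.
  split; first exact: bounded_cst.
  by exists 0 => x y; rewrite subrr normr0 mul0r.
rewrite /BL_norm; have -> : @sup_norm R S (cst 0) = 0.
  rewrite /sup_norm (_ : [set _ | _ in _] = [set 0]) ?sup1//.
  by apply/seteqP; split=> [_ [x _ <-]|_ ->]; [|exists point => //]; exact: normr0.
rewrite add0r /lipschitz_seminorm; set E := [set _ | _ in _].
have [->|/set0P E0] := eqVneq E set0; first by rewrite sup0.
by apply: ge_sup E0 _ => _ [xy _ <-]; rewrite /= subrr normr0 mul0r.
Qed.

Lemma dual_BL_has_sup mu : has_sup
  [set `|pairing mu f| | f in [set f | BL S f /\ BL_norm f <= 1]].
Proof.
split; first by exists `|pairing mu (cst 0)|, (cst 0) => //; exact: dual_BL_ball0.
exists (fine (pos_part mu setT) + fine (neg_part mu setT)) => _ [f [fBL f1] <-].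
have [fb [L fL]] := fBL.
have fle1 x : `|f x| <= 1.
  apply: le_trans f1; rewrite -[leLHS]addr0; apply: lerD.
    apply: ub_le_sup; last by exists x.
    case: fb => C [_ /(_ (C + 1))] fC; exists (C + 1) => _ [y _ <-].
    by apply: fC => //; rewrite ltrDl.
  rewrite /lipschitz_seminorm; set E := [set _ | _ in _].
  have [->|/set0P[q [xy xyne _]]] := eqVneq E set0; first by rewrite sup0.
  apply: (@le_trans _ _ (`|f xy.1 - f xy.2| / mdist xy.1 xy.2)).
    by rewrite divr_ge0// mdist_ge0.
  apply: ub_le_sup; last by exists xy.
  exists L => _ [[a b] /= ab <-].
  by rewrite ler_pdivrMr ?mdist_gt0.
have bnd (m : {finite_measure set (borel S) -> \bar R}) :
    `|\int[m]_x f x| <= fine (m setT).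
  have mfin : (m setT < +oo)%E by rewrite -ge0_fin_numE// fin_num_measure.
  have If := BL_integrable mfin fBL.
  apply: le_trans (le_normr_Rintegral _ If) _ => //.
  apply: (@le_trans _ _ (\int[m]_(x in setT) 1)).
    apply: le_Rintegral => //.
      exact: integrable_norm.
    exact: finite_measure_integrable_cst.
  by rewrite Rintegral_cst// mul1r.
by apply: le_trans (ler_normB _ _) (lerD (bnd _) (bnd _)).
Qed.

Lemma pairing_le_dual_BL_norm mu f : BL S f -> BL_norm f <= 1 ->
  `|pairing mu f| <= dual_BL_norm mu.
Proof.
by move=> fBL f1; apply: ub_le_sup; [case: (dual_BL_has_sup mu)|exists f].
Qed.

Lemma dual_BL_norm_le mu C :
  (forall f, BL S f -> BL_norm f <= 1 -> `|pairing mu f| <= C) ->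
  dual_BL_norm mu <= C.
Proof.
move=> h; apply: ge_sup => [|_ [f [fBL f1] <-]]; last exact: h.
by case: (dual_BL_has_sup mu).
Qed.

(* These balls depend on charges through their values on Borel sets only, so
   they form a pseudometric on charges and a metric on signed measures. *)
Definition dual_BL_ball mu (e : R) : set (signed_measure S) :=
  [set nu | dual_BL_norm (diff_measure nu mu) < e].

Lemma dual_BL_ball_center mu (e : R) : 0 < e -> dual_BL_ball mu e mu.
Proof.
move=> e0; apply: le_lt_trans e0; apply: dual_BL_norm_le => f fBL _.
by rewrite pairing_diff// subrr normr0.
Qed.

Lemma dual_BL_ball_sym mu nu (e : R) :
  dual_BL_ball mu e nu -> dual_BL_ball nu e mu.
Proof.
apply: le_lt_trans; apply: dual_BL_norm_le => f fBL f1.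
rewrite pairing_diff// distrC -pairing_diff//.
exact: pairing_le_dual_BL_norm.
Qed.

Lemma dual_BL_ball_triangle mu nu la (e1 e2 : R) :
  dual_BL_ball mu e1 nu -> dual_BL_ball nu e2 la ->
  dual_BL_ball mu (e1 + e2) la.
Proof.
move=> h1 h2; apply: le_lt_trans (ltrD h1 h2).
apply: dual_BL_norm_le => f fBL f1.
have -> : pairing (diff_measure la mu) f =
    pairing (diff_measure nu mu) f + pairing (diff_measure la nu) f.
  by rewrite !pairing_diff//; lra.
by apply: le_trans (ler_normD _ _) (lerD _ _); exact: pairing_le_dual_BL_norm.
Qed.

End dual_BL_pseudometric.

Definition dual_BL {R : realType} (S : completeMetricType R) : Type :=
  signed_measure S.

Section dual_BL_topology.
Context {R : realType} (S : completeMetricType R).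

HB.instance Definition _ := Choice.on (dual_BL S).
HB.instance Definition _ := hasNbhs.Build (dual_BL S)
  (nbhs_ (entourage_ (@dual_BL_ball R S))).
HB.instance Definition _ := @Nbhs_isPseudoMetric.Build R (dual_BL S)
  (entourage_ (@dual_BL_ball R S)) erefl (@dual_BL_ball R S)
  (@dual_BL_ball_center R S) (@dual_BL_ball_sym R S)
  (@dual_BL_ball_triangle R S) erefl.

End dual_BL_topology.

Definition dual_BL_open {R : realType} (S : completeMetricType R) :
  set (set (signed_measure S)) := @open (dual_BL S).
Arguments dual_BL_open {R} S _.

(* Main.v *)
Require Import Defs.
From mathcomp Require Import all_boot all_order all_algebra.
From mathcomp Require Import finmap.
From mathcomp Require Import all_classical all_reals all_analysis.
From mathcomp Require Import ring lra.

Set Implicit Arguments.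
Unset Strict Implicit.
Unset Printing Implicit Defensive.

Import Order.TTheory GRing.Theory Num.Theory.
Import numFieldNormedType.Exports.

Local Open Scope classical_set_scope.
Local Open Scope ring_scope.

(** The norm topology is finer than the weak one on all signed measures, since
|<mu, f>| <= BL_norm f * dual_BL_norm mu makes every weak functional
norm-continuous ([norm_pairing_le], [weak_BL_nbhs_dual]).

On a bounded and uniformly tight family M the converse holds because the unit
ball of BL is, up to a small error, finite as seen from M.  Take a compact K
that carries almost all the mass of every member of M.  By the Arzela-Ascoli
argument, finitely many g_1, ..., g_n of the unit ball approximate each f of the
unit ball uniformly on K ([BL_unit_ball_finite_net]).  For mu in M, replacing f
by its approximant changes <mu, f> by at most a small multiple of the total
variation, from K, plus twice the mass outside K, where both functions are
bounded by 1 ([norm_pairing_split]).  So if nu in M is close to mu against each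
g_i, which is a weak neighbourhood of mu, then it is close to mu uniformly
against the unit ball, that is, in the dual norm ([tight_dual_nbhs_weak]).

Both inclusions between traces on M then follow from comparing neighbourhoods
at the points of M ([trace_open_subset]). *)

(** * Bounded Lipschitz functions *)

Section BL_norm_theory.
Context {R : realType} {S : completeMetricType R}.
Implicit Types f g : S -> R.

(** This also covers sets without a supremum, whose [sup] is the default 0; the
seminorms below may be suprema of the empty set. *)
Lemma sup_nonneg (E : set R) : (forall x, E x -> 0 <= x) -> 0 <= sup E.
Proof.
move=> E0; have [hE|/sup_out ->//] := pselect (has_sup E).
by have [[x Ex] ubE] := hE; apply: le_trans (E0 x Ex) (ub_le_sup ubE Ex).
Qed.

Lemma BL_intro f (C L : R) : (forall x, `|f x| <= C) ->
  (forall x y, `|f x - f y| <= L * mdist x y) -> BL S f.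
Proof.
move=> fC fL; split; last by exists L.
exists C; split; first exact: num_real.
by move=> M /ltW CM x _; exact: le_trans (fC x) CM.
Qed.

Lemma sup_norm_ub f x : BL S f -> `|f x| <= sup_norm f.
Proof.
move=> [[C [_ /(_ (C + 1))]] fC _]; apply: ub_le_sup; last by exists x.
by exists (C + 1) => _ [y _ <-]; apply: fC => //; rewrite ltrDl.
Qed.

Lemma sup_norm_ge0 f : 0 <= sup_norm f.
Proof. by apply: sup_nonneg => _ [x _ <-]. Qed.

Lemma lipschitz_seminorm_ge0 f : 0 <= lipschitz_seminorm f.
Proof. by apply: sup_nonneg => _ [xy _ <-]; rewrite divr_ge0 ?mdist_ge0. Qed.

Lemma lipschitz_seminorm_ub f x y : BL S f ->
  `|f x - f y| <= lipschitz_seminorm f * mdist x y.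
Proof.
move=> [_ [L fL]]; have [->|xy] := eqVneq x y.
  by rewrite subrr normr0 mulr_ge0 ?lipschitz_seminorm_ge0 ?mdist_ge0.
rewrite -ler_pdivrMr ?mdist_gt0//; apply: ub_le_sup; last by exists (x, y).
by exists L => _ [[a b] /= ab <-]; rewrite ler_pdivrMr ?mdist_gt0.
Qed.

Lemma BL_unit_ballP f : BL S f -> BL_norm f <= 1 ->
  (forall x, -1 <= f x <= 1) /\ (forall x y, `|f x - f y| <= mdist x y).
Proof.
move=> fBL f1; split=> [x|x y].
  rewrite -ler_norml; apply: le_trans (sup_norm_ub x fBL) (le_trans _ f1).
  by rewrite lerDl lipschitz_seminorm_ge0.
apply: le_trans (lipschitz_seminorm_ub x y fBL) _.
rewrite ler_piMl ?mdist_ge0//; apply: le_trans f1.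
by rewrite lerDr sup_norm_ge0.
Qed.

Lemma BL_norm_le f (C L : R) : 0 <= L ->
  (forall x, `|f x| <= C) -> (forall x y, `|f x - f y| <= L * mdist x y) ->
  BL_norm f <= C + L.
Proof.
move=> L0 fC fL; apply: lerD.
  by apply: ge_sup => [|_ [x _ <-]//]; exists `|f point|, point.
rewrite /lipschitz_seminorm; set E := [set _ | _ in _].
have [->|/set0P E0] := eqVneq E set0; first by rewrite sup0.
apply: ge_sup E0 _ => _ [[x y] /= xy <-].
by rewrite ler_pdivrMr ?mdist_gt0.
Qed.

Lemma BLB f g : BL S f -> BL S g -> BL S (f - g).
Proof.
move=> fBL gBL.
apply: (@BL_intro _ (sup_norm f + sup_norm g)
  (lipschitz_seminorm f + lipschitz_seminorm g)) => [x|x y].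
  by apply: le_trans (ler_normB _ _) (lerD _ _); exact: sup_norm_ub.
rewrite mulrDl; have -> : (f - g) x - (f - g) y = (f x - f y) - (g x - g y).
  by rewrite !fctE; lra.
by apply: le_trans (ler_normB _ _) (lerD _ _); exact: lipschitz_seminorm_ub.
Qed.

Lemma BLZ f (c : R) : BL S f -> BL S (fun x => c * f x).
Proof.
move=> fBL; apply: (@BL_intro _ (`|c| * sup_norm f)
  (`|c| * lipschitz_seminorm f)) => [x|x y].
  by rewrite normrM ler_wpM2l// sup_norm_ub.
by rewrite -mulrBr normrM -mulrA ler_wpM2l// lipschitz_seminorm_ub.
Qed.

End BL_norm_theory.

(** * Pairing with signed measures *)

Section pairing_theory.
Context {R : realType} {S : completeMetricType R}.
Implicit Types (mu nu : signed_measure S) (f g : S -> R).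

Lemma finite_measure_lty (m : {finite_measure set (borel S) -> \bar R}) :
  (m setT < +oo)%E.
Proof. by rewrite -ge0_fin_numE// fin_num_measure. Qed.

Lemma pairingB mu f g : BL S f -> BL S g ->
  pairing mu (f - g) = pairing mu f - pairing mu g.
Proof.
move=> fBL gBL; rewrite /pairing.
have B (m : {finite_measure set (borel S) -> \bar R}) :
    \int[m]_x (f - g) x = \int[m]_x f x - \int[m]_x g x.
  by apply: RintegralB => //; apply: BL_integrable => //; exact: finite_measure_lty.
rewrite !B; lra.
Qed.

Lemma pairingZ mu f (c : R) : BL S f ->
  pairing mu (fun x => c * f x) = c * pairing mu f.
Proof.
move=> fBL; rewrite /pairing.
have Z (m : {finite_measure set (borel S) -> \bar R}) :
    \int[m]_x (c * f x) = c * \int[m]_x f x.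
  by apply: RintegralZl => //; apply: BL_integrable => //; exact: finite_measure_lty.
by rewrite !Z mulrBr.
Qed.

Lemma compact_borel (K : set S) : compact K -> measurable (K : set (borel S)).
Proof.
move=> /(compact_closed (@metric_hausdorff _ S)) cK.
rewrite -[K]setCK; apply: measurableC.
by apply: sub_sigma_algebra; exact: closed_openC.
Qed.

(** Two bounds on the integrand are traded against two masses: the small bound
[a] on [K] against the whole mass, the crude bound [b] only against the mass
that escapes [K]. *)
Lemma norm_Rintegral_split (m : {finite_measure set (borel S) -> \bar R})
    (K : set (borel S)) f (a b : R) :
  measurable K -> BL S f -> 0 <= a -> (forall x, K x -> `|f x| <= a) ->
  (forall x, `|f x| <= b) ->
  `|\int[m]_x f x| <= a * fine (m setT) + b * fine (m (~` K)).
Proof.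
move=> mK fBL a0 fa fb.
have If := BL_integrable (finite_measure_lty m) fBL.
have Inf : m.-integrable setT (EFin \o (fun x => `|f x|)).
  exact: integrable_norm.
have le_cst (D : set (borel S)) (c : R) : measurable D ->
    (forall x, D x -> `|f x| <= c) -> \int[m]_(x in D) `|f x| <= c * fine (m D).
  move=> mD fc; rewrite -Rintegral_cst//; apply: le_Rintegral => //.
    exact: integrableS Inf.
  exact: finite_measure_integrable_cst.
apply: le_trans (le_normr_Rintegral measurableT If) _.
rewrite -[X in \int[m]_(x in X) _](setUv K) Rintegral_setU//; last 3 first.
- exact: measurableC.
- by rewrite setUv.
- by apply/disj_set2P; rewrite setICr.
apply: lerD; last by apply: le_cst => //; exact: measurableC.
apply: le_trans (le_cst K a mK fa) _.
rewrite ler_wpM2l// fine_le ?fin_num_measure//.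
by apply: le_measure; rewrite ?inE.
Qed.

Lemma fine_variation mu (A : set (borel S)) : measurable A ->
  fine (Defs.variation mu A) = fine (pos_part mu A) + fine (neg_part mu A).
Proof. by move=> mA; rewrite -fineD// fin_num_measure. Qed.

Lemma norm_pairing_split mu (K : set (borel S)) f (a b : R) :
  measurable K -> BL S f -> 0 <= a -> (forall x, K x -> `|f x| <= a) ->
  (forall x, `|f x| <= b) ->
  `|pairing mu f| <= a * fine (TV_norm mu) + b * fine (Defs.variation mu (~` K)).
Proof.
move=> mK fBL a0 fa fb.
rewrite /TV_norm !fine_variation//; last exact: measurableC.
apply: le_trans (ler_normB _ _) _.
have P m := @norm_Rintegral_split m K f a b mK fBL a0 fa fb.
by apply: le_trans (lerD (P _) (P _)) _; lra.
Qed.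

(** The dual norm is a supremum over the unit ball, so the bound is obtained by
normalising [f].  When [BL_norm f] is 0 normalisation is impossible, but then
[f] vanishes everywhere and so does the pairing. *)
Lemma norm_pairing_le mu f : BL S f ->
  `|pairing mu f| <= BL_norm f * dual_BL_norm mu.
Proof.
move=> fBL; have s0 := sup_norm_ge0 f; have l0 := lipschitz_seminorm_ge0 f.
have : 0 <= BL_norm f by rewrite addr_ge0.
rewrite le_eqVlt => /predU1P[n0|n0].
  have f0 x : `|f x| <= 0.
    by rewrite n0; apply: le_trans (sup_norm_ub x fBL) _; rewrite lerDl.
  have := @norm_pairing_split mu setT f 0 0 measurableT fBL (lexx _).
  by rewrite -n0 !mul0r addr0; apply.
rewrite mulrC -ler_pdivrMr//.
have -> : `|pairing mu f| / BL_norm f = `|pairing mu (fun x => (BL_norm f)^-1 * f x)|.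
  by rewrite pairingZ// normrM mulrC (ger0_norm (ltW _)) ?invr_gt0.
apply: pairing_le_dual_BL_norm; first exact: BLZ.
have i0 : 0 < (BL_norm f)^-1 by rewrite invr_gt0.
apply: (@le_trans _ _ ((BL_norm f)^-1 * sup_norm f +
                       (BL_norm f)^-1 * lipschitz_seminorm f)).
  apply: BL_norm_le => [|x|x y].
  - by rewrite mulr_ge0// ltW.
  - by rewrite normrM (gtr0_norm i0) ler_pM2l// sup_norm_ub.
  - by rewrite -mulrBr normrM (gtr0_norm i0) -mulrA ler_pM2l// lipschitz_seminorm_ub.
by rewrite -mulrDr mulVf// gt_eqF.
Qed.

End pairing_theory.

(** * Neighbourhoods in the two topologies *)

Section weak_and_dual_neighborhoods.
Context {R : realType} {S : completeMetricType R}.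
Implicit Types (mu nu : signed_measure S) (f : S -> R).

Lemma weak_BL_nbhs mu f (e : R) : BL S f -> 0 < e ->
  nbhs (mu : weak_BL S) [set nu | `|pairing nu f - pairing mu f| < e].
Proof.
move=> fBL e0; pose F : BL S := exist _ f (mem_set fBL).
have /(_ F) := (cvg_sup (fun f : BL S => Topological.on
  (initial_topology (fun mu : signed_measure S => pairing mu (val f))))
  (mu : weak_BL S) (nbhs_filter (mu : weak_BL S))).1 cvg_id.
apply; apply: (@initial_continuous (signed_measure S) R (fun mu => pairing mu f)
  mu [set y | `|y - pairing mu f| < e]).
by apply/nbhs_ballP; exists e => // x /=; rewrite /ball/= distrC.
Qed.

Lemma dual_BL_nbhs_ball mu (A : set (signed_measure S)) :
  nbhs (mu : dual_BL S) A <-> exists2 e : R, 0 < e & dual_BL_ball mu e `<=` A.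
Proof.
by split => [/nbhs_ballP[e]|[e e0 eA]]; [exists e|apply/nbhs_ballP; exists e].
Qed.

(** It suffices to check each initial topology that enters the supremum, and
there [norm_pairing_le] bounds the change of the functional. *)
Lemma weak_BL_nbhs_dual mu (A : set (signed_measure S)) :
  nbhs (mu : weak_BL S) A -> nbhs (mu : dual_BL S) A.
Proof.
apply: (cvg_sup (fun f : BL S => Topological.on
  (initial_topology (fun mu : signed_measure S => pairing mu (val f))))
  (mu : weak_BL S) (nbhs_filter (mu : dual_BL S))).2 => -[f fBL'] U.
have fBL := set_mem fBL'.
rewrite nbhsE => -[_ [[V oV <-] /= Vmu] /filterS]; apply.
have /nbhs_ballP[e e0 eV] : nbhs (pairing mu f) V by exact: open_nbhs_nbhs.
(* The norm of f may be 0, so the radius is divided by BL_norm f + 1. *)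
have n0 : 0 < BL_norm f + 1.
  by rewrite ltr_wpDl// addr_ge0 ?sup_norm_ge0 ?lipschitz_seminorm_ge0.
apply/dual_BL_nbhs_ball; exists (e / (BL_norm f + 1)); first exact: divr_gt0.
move=> nu; rewrite /dual_BL_ball/= ltr_pdivlMr// => nue; apply: eV.
rewrite /ball/= distrC -pairing_diff//.
apply: le_lt_trans (norm_pairing_le _ fBL) (le_lt_trans _ nue).
rewrite mulrC ler_wpM2l ?lerDl//.
apply: le_trans (normr_ge0 _) (pairing_le_dual_BL_norm _ dual_BL_ball0.1 dual_BL_ball0.2).
Qed.

End weak_and_dual_neighborhoods.

(** * Arzela-Ascoli on a compact set *)

Section finite_net.
Context {R : realType} {S : completeMetricType R}.

Lemma compact_finite_net (K : set S) (d : R) : compact K -> 0 < d ->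
  exists D : {fset S}, forall x, K x -> exists y : D, mdist (val y) x < d.
Proof.
move=> cK d0; move: cK; rewrite compact_cover.
move=> /(_ S setT (fun y => (ball y d)^°)) [y _|x _|D _ KD].
- exact: open_interior.
- by exists x => //; apply: nbhsx_ballx.
exists D => x /KD[y yD] /interior_subset; rewrite ballEmdist => yx.
by exists [` yD]%fset.
Qed.

(** A map to a finite type has finitely many fibres, so [A] is covered by those
of finitely many of its own elements.  Fibres that miss [A] get an arbitrary
element of [A] as representative, which keeps [g] total and valued in [A]. *)
Lemma finite_fiber_representatives (X : pointedType) (T : finType)
    (p : X -> T) (A : set X) : A !=set0 ->
  exists g : T -> X, (forall t, A (g t)) /\ forall x, A x -> p x = p (g (p x)).
Proof.
move=> [x0 Ax0].
have /choice[g gP] t : exists y, A y /\ forall x, A x -> p x = t -> p y = t.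
  have [[y [Ay yt]]|no] := pselect (exists y, A y /\ p y = t).
    by exists y.
  by exists x0; split => // x Ax xt; case: no; exists x.
exists g; split => [t|x Ax]; first by case: (gP t).
by rewrite ((gP (p x)).2 x).
Qed.

Lemma truncn_eq_dist (a b d : R) : 0 < d -> 0 <= a -> 0 <= b ->
  Num.truncn (a / d) = Num.truncn (b / d) -> `|a - b| < d.
Proof.
move=> d0 a0 b0 ab.
have /andP[a1 a2] := truncn_itv (divr_ge0 a0 (ltW d0)).
have /andP[] := truncn_itv (divr_ge0 b0 (ltW d0)); rewrite -ab => b1 b2.
move: a1 a2 b1 b2; rewrite !ler_pdivlMr// !ltr_pdivrMr// -natr1 mulrDl mul1r.
move=> *; rewrite ltr_norml; apply/andP; split; lra.
Qed.

(** A function of the unit ball is 1-Lipschitz with values in [-1, 1], so it is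
determined on [K] up to [3 * d] by its values, rounded to multiples of [d], on a
finite [d]-net of [K]: one [d] for rounding and one for each of the two moves
from a point of [K] to the net.  There are finitely many such rounded profiles;
[p] computes the profile and [g] picks a function of the unit ball for each. *)
Lemma BL_unit_ball_finite_net (K : set S) (d : R) : compact K -> 0 < d ->
  exists (T : finType) (p : (S -> R) -> T) (g : T -> S -> R),
    (forall t, BL S (g t) /\ BL_norm (g t) <= 1) /\
    forall f, BL S f -> BL_norm f <= 1 ->
      forall x, K x -> `|f x - g (p f) x| <= 3 * d.
Proof.
move=> cK d0; have [D KD] := compact_finite_net cK d0.
(* Shifting by 1 makes the values lie in [0, 2], where truncation rounds
   consistently and stays below N + 1. *)
pose N := Num.truncn (2 / d).
pose p (f : S -> R) : {ffun D -> 'I_N.+1} :=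
  [ffun y => inord (Num.truncn ((f (val y) + 1) / d))].
have [g [gB gp]] := @finite_fiber_representatives _ _ p
  [set f | BL S f /\ BL_norm f <= 1] (ex_intro _ _ dual_BL_ball0).
exists {ffun D -> 'I_N.+1}, p, g; split=> // f fBL f1 x Kx.
have [fb fl] := BL_unit_ballP fBL f1.
have [gb gl] := BL_unit_ballP (gB (p f)).1 (gB (p f)).2.
have [y yx] := KD x Kx.
have fg : `|f (val y) - g (p f) (val y)| < d.
  have fg2 : Num.truncn ((f (val y) + 1) / d) =
             Num.truncn ((g (p f) (val y) + 1) / d).
    have /ffunP/(_ y) := gp f (conj fBL f1); rewrite !ffunE.
    move=> /(congr1 (@nat_of_ord _)); rewrite !inordK// ltnS.
      by apply: le_truncn; rewrite ler_pM2r ?invr_gt0//; move: (gb (val y)); lra.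
    by apply: le_truncn; rewrite ler_pM2r ?invr_gt0//; move: (fb (val y)); lra.
  have -> : f (val y) - g (p f) (val y) =
      (f (val y) + 1) - (g (p f) (val y) + 1) by lra.
  by apply: truncn_eq_dist => //; move: (fb (val y)) (gb (val y)); lra.
move: (le_lt_trans (fl (val y) x) yx) (le_lt_trans (gl (val y) x) yx) fg.
by rewrite !ltr_norml => ? ? ?; rewrite ler_norml; lra.
Qed.

End finite_net.

(** * The two topologies on a bounded tight family *)

(** The maximum with 0 gives a finite bound also when [M] is empty, where the
supremum is -oo. *)
Lemma TV_bound (R : realType) (S : completeMetricType R)
    (M : set (signed_measure S)) :
  (ereal_sup [set TV_norm mu | mu in M] < +oo)%E ->
  exists2 C : R, 0 <= C & forall mu, M mu -> fine (TV_norm mu) <= C.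
Proof.
set s := ereal_sup _ => s_lty.
have s0 : (0 <= Order.max 0 s)%E by rewrite le_max lexx.
have sfin : Order.max 0%E s \is a fin_num.
  by rewrite ge0_fin_numE// gt_max s_lty ltry.
exists (fine (Order.max 0%E s)); first exact: fine_ge0.
move=> mu Mmu; apply: fine_le => //; first by apply: fin_num_measure.
by rewrite le_max; apply/orP; right; apply: ereal_sup_ubound; exists mu.
Qed.

(** The difference <nu, f> - <mu, f> splits into three terms: the replacement of
[f] by its approximant [g (p f)] under [nu], the same under [mu], and the
difference of [nu] and [mu] on the approximant.  Each is made at most [e / 4],
which leaves room for the strict inequality in the ball. *)
Lemma tight_dual_nbhs_weak (R : realType) (S : completeMetricType R)
    (M : set (signed_measure S)) mu (e : R) :
  (ereal_sup [set TV_norm mu | mu in M] < +oo)%E -> uniformly_tight M ->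
  M mu -> 0 < e ->
  exists2 W, nbhs (mu : weak_BL S) W & W `&` M `<=` dual_BL_ball mu e.
Proof.
move=> TVM tightM Mmu e0; have [C C0 MC] := TV_bound TVM.
have C1 : 0 < C + 1 by lra.
have [|K cK MK] := tightM (e / 16); first lra.
(* With C bounding the total variations, the part on K costs 3 * d * C <= e / 8
   and the part off K costs 2 * (e / 16). *)
pose d := e / (24 * (C + 1)).
have d0 : 0 < d by rewrite divr_gt0// mulr_gt0.
have dC : 24 * (d * C) <= e.
  have -> : 24 * (d * C) = e * (C / (C + 1)) by rewrite /d; field; rewrite gt_eqF.
  by rewrite ler_piMr//; [exact: ltW|rewrite ler_pdivrMr//; lra].
have [T [p [g [gB gp]]]] := BL_unit_ball_finite_net cK d0.
exists [set nu | forall t, `|pairing nu (g t) - pairing mu (g t)| < e / 4].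
  apply: (filter_forall (nbhs_filter (mu : weak_BL S))) => t.
  by apply: weak_BL_nbhs; [case: (gB t)|lra].
move=> nu [Wnu Mnu].
have tail la f : M la -> BL S f -> BL_norm f <= 1 ->
    `|pairing la f - pairing la (g (p f))| <= e / 4.
  move=> Mla fBL f1; have [gBL g1] := gB (p f).
  rewrite -pairingB//.
  have [fb _] := BL_unit_ballP fBL f1; have [gb _] := BL_unit_ballP gBL g1.
  apply: (le_trans (@norm_pairing_split _ _ la K _ (3 * d) 2
    (compact_borel cK) (BLB fBL gBL) _ _ _)).
  - by rewrite mulr_ge0// ltW.
  - by move=> x Kx; exact: gp.
  - move=> x; rewrite !fctE ler_norml; move: (fb x) (gb x); lra.
  have h1 : d * fine (TV_norm la) <= d * C by rewrite ler_pM2l// MC.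
  have h2 : fine (Defs.variation la (~` K)) <= e / 16.
    rewrite -lee_fin fineK; first exact: ltW (MK la Mla).
    by apply: fin_num_measure; apply: measurableC; exact: compact_borel.
  lra.
rewrite /dual_BL_ball/=; apply: (@le_lt_trans _ _ (3 * (e / 4))); last lra.
apply: dual_BL_norm_le => f fBL f1; rewrite pairing_diff//.
have := Wnu (p f); move: (tail nu f Mnu fBL f1) (tail mu f Mmu fBL f1) => /=.
by rewrite !ler_norml ltr_norml; lra.
Qed.

(** Neighbourhoods are compared at the points of [M] only, so a set open for
[T1] need not be open for [T2]; its trace is recovered from the union of all
[T2]-open sets whose trace on [M] it contains. *)
Lemma trace_open_subset (T : choiceType) (T1 T2 : Topological T) (M : set T) :
  (forall (x : T) (U : set T), M x -> nbhs (x : Topological.Pack T1) U ->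
     exists2 W, nbhs (x : Topological.Pack T2) W & W `&` M `<=` U) ->
  [set U `&` M | U in @open (Topological.Pack T1)] `<=`
  [set U `&` M | U in @open (Topological.Pack T2)].
Proof.
move=> T12 _ [U oU <-].
exists (\bigcup_(W in [set W | @open (Topological.Pack T2) W /\
                               W `&` M `<=` U]) W).
  by apply: bigcup_open => W [].
apply/seteqP; split=> [x [[W [_ WMU] Wx] Mx]|x [Ux Mx]].
  by split=> //; exact: WMU.
have [|W] := T12 x U Mx; first exact: open_nbhs_nbhs.
rewrite nbhsE => -[V [oV Vx] VW] WMU; split=> //.
by exists V => //; split=> // y [Vy My]; apply: WMU; split=> //; exact: VW.
Qed.

Theorem corollary3p2 (R : realType) (S : completeMetricType R)
    (M : set (signed_measure S)) :
  separable_space S ->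
  (ereal_sup [set TV_norm mu | mu in M] < +oo)%E ->
  uniformly_tight M ->
  [set U `&` M | U in weak_BL_open S] =
  [set U `&` M | U in dual_BL_open S].
Proof.
move=> _ TVM tightM; apply/seteqP; split.
- apply: (@trace_open_subset _ (Topological.on (weak_BL S))
    (Topological.on (dual_BL S))) => mu U _ /weak_BL_nbhs_dual ?.
  by exists U => // nu [].
- apply: (@trace_open_subset _ (Topological.on (dual_BL S))
    (Topological.on (weak_BL S))) => mu U Mmu /dual_BL_nbhs_ball[e e0 eU].
  have [W Wmu WM] := tight_dual_nbhs_weak TVM tightM Mmu e0.
  by exists W => //; exact: subset_trans eU.
Qed.
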